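(* Let $p,q$ be coprime positive integers, let $n\ge 2$, let $K_{p,q}\subset S^3$ be the torus knot of type $(p,q)$ with knot group $G_{p,q}=\langle x,y\mid x^p=y^q\rangle$, and let $\mathcal{X}_n^*$ be the space of characters of irreducible representations $G_{p,q}\to \mathrm{SL}_n(\mathbb{C})$. Then the coefficients of the twisted Alexander polynomial $\Delta_{K_{p,q}}^{\rho}(t)$ associated with irreducible representations $\rho\colon G_{p,q}\to \mathrm{SL}_n(\mathbb{C})$ are locally constant as functions on $\mathcal{X}_n^*$. Moreover, $\Delta_{K_{p,q}}^{\rho}(t)\in\mathbb{A}[t^{\pm1}]$ for every irreducible $\rho\colon G_{p,q}\to\mathrm{SL}_n(\mathbb{C})$, where $\mathbb{A}\subset\mathbb{C}$ is the ring of all algebraic integers.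
   Context: Twisted Alexander polynomial: let $K\subset S^3$ be a knot with group $G(K)=\pi_1(E(K))$, $E(K)$ the knot exterior, and fix a deficiency-one presentation $G(K)=\langle x_1,\dots,x_\ell\mid r_1,\dots,r_{\ell-1}\rangle$. Let $\phi\colon G(K)\to\mathbb{Z}\cong\langle t\rangle$ be the abelianization. For a representation $\rho\colon G(K)\to\mathrm{SL}_n(\mathbb{C})$ let $\Phi\colon\mathbb{Z}[F_\ell]\to\mathrm{Mat}_n(\mathbb{C}[t^{\pm1}])$ be the ring homomorphism from the group ring of the free group $F_\ell=\langle x_1,\dots,x_\ell\rangle$ induced by $x\mapsto\phi(x)\rho(x)$. Let $M$ be the $(\ell-1)\times\ell$ matrix with $(i,j)$ block $\Phi(\partial r_i/\partial x_j)$ (Fox free derivatives), and $M_k$ the matrix obtained by deleting the $k$-th block column, regarded as an $n(\ell-1)\times n(\ell-1)$ matrix over $\mathbb{C}[t^{\pm1}]$. Then $\Delta_K^\rho(t)=\det M_k/\det\Phi(x_k-1)$, well defined up to multiplication by $\pm t^i$, $i\in\mathbb{Z}$. For $K_{p,q}$ with the presentation $\langle x,y\mid x^py^{-q}\rangle$ one has $\phi(x)=t^q$, $\phi(y)=t^p$. The character variety $\mathcal{X}_n=X(G_{p,q},\mathrm{SL}_n(\mathbb{C}))$ is the image of $\mathrm{Hom}(G_{p,q},\mathrm{SL}_n(\mathbb{C}))$ under $\rho\mapsto\chi_\rho$, $\chi_\rho(g)=\mathrm{tr}\,\rho(g)$, an affine algebraic set (with the topology inherited from an embedding in some $\mathbb{C}^N$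 by finitely many trace functions); $\mathcal{X}_n^*\subset\mathcal{X}_n$ consists of the characters of irreducible representations. The polynomial $\Delta^\rho_{K_{p,q}}(t)$ depends only on $\chi_\rho$ for irreducible $\rho$. All statements about $\Delta_{K_{p,q}}^\rho(t)$ are understood up to the indeterminacy $\pm t^i$; local constancy means that every point of $\mathcal{X}_n^*$ has a neighbourhood in $\mathcal{X}_n^*$ on which the polynomials can be represented by one fixed Laurent polynomial. *)

(* Defs.v *)
From HB Require Import structures.
From mathcomp Require Import all_boot all_order all_algebra.
From mathcomp Require Import boolp classical_sets reals topology normedtype.
From mathcomp.real_closed Require Import complex.
From mathcomp Require mpoly.

Set Implicit Arguments.
Unset Strict Implicit.
Unset Printing Implicit Defensive.

Import Order.TTheory GRing.Theory Num.Theory.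
Import numFieldNormedType.Exports.
Local Open Scope quotient_scope.
Local Open Scope ring_scope.
Local Open Scope classical_set_scope.
Local Open Scope complex_scope.

(* The letter (i, true) stands for x_i and (i, false) for x_i^-1. *)
Definition word (l : nat) := seq ('I_l * bool).

Definition winv l (w : word l) : word l := rev [seq (a.1, ~~ a.2) | a <- w].

Section PresentedGroup.
Variables (l m : nat) (r : 'I_m -> word l).

Inductive pres_eq : word l -> word l -> Prop :=
| pres_refl w : pres_eq w w
| pres_sym v w : pres_eq v w -> pres_eq w v
| pres_trans u v w : pres_eq u v -> pres_eq v w -> pres_eq u w
| pres_cat v v' w w' :
    pres_eq v v' -> pres_eq w w' -> pres_eq (v ++ w) (v' ++ w')
| pres_cancel i b : pres_eq [:: (i, b); (i, ~~ b)] [::]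
| pres_rel j : pres_eq (r j) [::].

Definition pres_eqb : rel (word l) := fun v w => `[< pres_eq v w >].

Lemma pres_eqb_refl : reflexive pres_eqb.
Proof. by move=> w; apply/asboolP; exact: pres_refl. Qed.

Lemma pres_eqb_sym : symmetric pres_eqb.
Proof. by move=> v w; apply/asboolP/asboolP; exact: pres_sym. Qed.

Lemma pres_eqb_trans : transitive pres_eqb.
Proof.
by move=> v u w /asboolP uv /asboolP vw; apply/asboolP; exact: pres_trans vw.
Qed.

Canonical pres_equiv_rel :=
  EquivRel pres_eqb pres_eqb_refl pres_eqb_sym pres_eqb_trans.

(* The group < x_0, ..., x_(l-1) | r_0, ..., r_(m-1) >. *)
Definition pres_group := {eq_quot pres_equiv_rel}.
HB.instance Definition _ := Choice.on pres_group.

Definition word_class (w : word l) : pres_group := \pi_{eq_quot pres_equiv_rel} w.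

Lemma word_class_eq v w : (word_class v = word_class w) <-> pres_eq v w.
Proof. by split=> [/eqmodP/asboolP|vw]; last exact/eqmodP/asboolP. Qed.

Lemma word_class_repr (g : pres_group) :
  word_class (repr (g : {eq_quot pres_equiv_rel})) = g.
Proof. exact: reprK. Qed.

Lemma pres_eq_winvl w : pres_eq (winv w ++ w) [::].
Proof.
elim: w => [|[i b] w IHw]; first exact: pres_refl.
rewrite /winv /= rev_cons cat_rcons -/(winv w).
apply: pres_trans IHw; apply: pres_cat; first exact: pres_refl.
rewrite -[_ :: _]/([:: (i, ~~ b); (i, b)] ++ w) -[w in pres_eq _ w]cat0s.
apply: pres_cat; last exact: pres_refl.
by rewrite -{2}(negbK b); exact: pres_cancel.
Qed.

Lemma winvK : involutive (@winv l).
Proof.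
move=> w; rewrite /winv map_rev revK -map_comp -[RHS]map_id.
by apply: eq_map => -[i b] /=; rewrite negbK.
Qed.

Lemma pres_eq_winvr w : pres_eq (w ++ winv w) [::].
Proof. by rewrite -{1}(winvK w); exact: pres_eq_winvl. Qed.

Lemma pres_eq_winv v w : pres_eq v w -> pres_eq (winv v) (winv w).
Proof.
move=> vw; apply: (@pres_trans _ (winv v ++ (w ++ winv w))).
  rewrite -[X in pres_eq X _]cats0; apply: pres_cat; first exact: pres_refl.
  exact/pres_sym/pres_eq_winvr.
rewrite catA -[X in pres_eq _ X]cat0s; apply: pres_cat; last exact: pres_refl.
apply: pres_trans (pres_eq_winvl v).
by apply: pres_cat; [exact: pres_refl | exact: pres_sym].
Qed.

Definition pres_repr (g : pres_group) : word l :=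
  repr (g : {eq_quot pres_equiv_rel}).

Definition pres_mul (g h : pres_group) : pres_group :=
  word_class (pres_repr g ++ pres_repr h).
Definition pres_inv (g : pres_group) : pres_group :=
  word_class (winv (pres_repr g)).

Lemma pres_reprE w : pres_eq (pres_repr (word_class w)) w.
Proof. by apply/word_class_eq; exact: word_class_repr. Qed.

Lemma pres_mulE v w :
  pres_mul (word_class v) (word_class w) = word_class (v ++ w).
Proof. by apply/word_class_eq; apply: pres_cat; exact: pres_reprE. Qed.

Lemma pres_invE w : pres_inv (word_class w) = word_class (winv w).
Proof. by apply/word_class_eq/pres_eq_winv; exact: pres_reprE. Qed.

Lemma pres_mulA : associative pres_mul.
Proof.
move=> f g h; rewrite -(word_class_repr f) -(word_class_repr g).
by rewrite -(word_class_repr h) !pres_mulE catA.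
Qed.

Lemma pres_mul1 : left_id (word_class [::]) pres_mul.
Proof. by move=> g; rewrite -(word_class_repr g) pres_mulE. Qed.

Lemma pres_mulr1 : right_id (word_class [::]) pres_mul.
Proof. by move=> g; rewrite -(word_class_repr g) pres_mulE cats0. Qed.

Lemma pres_mulV : left_inverse (word_class [::]) pres_inv pres_mul.
Proof.
move=> g; rewrite -(word_class_repr g) pres_invE pres_mulE.
exact/word_class_eq/pres_eq_winvl.
Qed.

Lemma pres_mulrV : right_inverse (word_class [::]) pres_inv pres_mul.
Proof.
move=> g; rewrite -(word_class_repr g) pres_invE pres_mulE.
exact/word_class_eq/pres_eq_winvr.
Qed.

HB.instance Definition _ := isGroup.Build pres_group
  pres_mulA pres_mul1 pres_mulr1 pres_mulV pres_mulrV.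

End PresentedGroup.

Section Representations.
Variables (C : fieldType) (G : groupType) (n : nat).

Record sl_rep := SLRep {
  rep_fun :> G -> 'M[C]_n;
  rep1 : rep_fun 1%g = 1%:M;
  repM : forall g h, rep_fun (g * h)%g = rep_fun g *m rep_fun h;
  rep_det : forall g, \det (rep_fun g) = 1 }.

(* rho acts on column vectors, whereas the subspaces of MathComp are spanned
   by rows: U encodes { u | u^T in the row space of U }, hence the transpose. *)
Definition irreducible_rep (rho : sl_rep) : Prop :=
  (0 < n)%N /\
  forall U : 'M[C]_n, (forall g, stablemx U (rho g)^T) ->
    \rank U = 0%N \/ \rank U = n.

Definition rep_char (rho : sl_rep) : G -> C := fun g => \tr (rho g).

Definition irr_chars : set (G -> C) :=
  [set chi | exists2 rho, irreducible_rep rho & chi = rep_char rho].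

(* The trace functions at e_0, ..., e_(N-1) embed the character variety in C^N:
   they generate the algebra of all trace functions, i.e. its coordinate
   ring. *)
Definition trace_embedding N (e : 'I_N -> G) : Prop :=
  forall g, exists P : mpoly.mpoly N C,
    forall rho : sl_rep,
      rep_char rho g = mpoly.meval (fun i => rep_char rho (e i)) P.

End Representations.

Arguments irr_chars : clear implicits.
Arguments trace_embedding : clear implicits.

Section CharacterTopology.
Variables (R : realType) (G : groupType) (n N : nat) (e : 'I_N -> G).

Definition trace_coords (chi : G -> R[i]) : 'rV[R[i]^o]_N :=
  \row_i chi (e i).

(* The relatively open subsets of the space of irreducible characters, for the
   topology inherited from C^N through trace_coords. *)
Definition open_irr_chars (V : set (G -> R[i])) : Prop :=
  exists2 U : set 'rV[R[i]^o]_N, open U &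
    V = irr_chars R[i] G n `&` trace_coords @^-1` U.

End CharacterTopology.

Section Laurent.
Variable C : fieldType.

(* The Laurent polynomials C[t^+-1] are handled inside C(t). *)
Definition tvar : {fraction {poly C}} := tofrac 'X.

Definition laurent_over (S : C -> Prop) (f : {fraction {poly C}}) : Prop :=
  exists (P : {poly C}) (m : nat),
    (forall i, S P`_i) /\ f = tofrac P / tvar ^+ m.

Definition eq_upto_unit (f g : {fraction {poly C}}) : Prop :=
  exists (b : bool) (i : int), f = (-1) ^+ b * tvar ^ i * g.

End Laurent.

(* Formal sums of words with integer coefficients; they represent the elements
   of the group ring Z[F_l]. *)
Definition zword (l : nat) := seq (int * word l).

(* Fox derivative with respect to x_j:
   d(uv) = du + u dv, d(x_i) = delta_ij, d(x_i^-1) = - delta_ij x_i^-1. *)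
Fixpoint fox l (j : 'I_l) (w : word l) : zword l :=
  if w is a :: w' then
    (if a.1 == j then
       [:: if a.2 then (1, [::]) else (- 1, [:: (j, false)])] else [::])
    ++ [seq (u.1, a :: u.2) | u <- fox j w']
  else [::].

(* x_j - 1 *)
Definition gen_sub1 l (j : 'I_l) : zword l :=
  [:: (1, [:: (j, true)]); (- 1, [::])].

Section TwistedAlexander.
(* A deficiency-one presentation, and phi i the exponent of t in the image of
   x_i under the abelianization. *)
Variables (C : fieldType) (l : nat) (r : 'I_l -> word l.+1).
Variables (phi : 'I_l.+1 -> int) (n : nat) (rho : sl_rep C (pres_group r) n).

Definition word_weight (w : word l.+1) : int :=
  \sum_(a <- w) (if a.2 then phi a.1 else - phi a.1).

Definition Phi_word (w : word l.+1) : 'M[{fraction {poly C}}]_n :=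
  tvar C ^ word_weight w *:
    map_mx (fun c => tofrac c%:P) (rho (word_class r w)).

Definition Phi (s : zword l.+1) : 'M[{fraction {poly C}}]_n :=
  \sum_(u <- s) Phi_word u.2 *~ u.1.

Definition alexander_mx (k : 'I_l.+1) :=
  \mxblock_(i < l, j < l) Phi (fox (lift k j) (r i)).

Definition twisted_alexander (k : 'I_l.+1) : {fraction {poly C}} :=
  \det (alexander_mx k) / \det (Phi (gen_sub1 k)).

End TwistedAlexander.

Section TorusKnot.
Variables p q : nat.

(* The generators x, y are x_0, x_1; the relator is x^p y^-q. *)
Definition torus_rel (_ : 'I_1) : word 2 :=
  nseq p (ord0, true) ++ nseq q (ord_max, false).

Definition torus_group : groupType := pres_group torus_rel.

Definition torus_phi (i : 'I_2) : int := if i == ord0 then q else p.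

Definition torus_alexander (C : fieldType) n
    (rho : sl_rep C torus_group n) (k : 'I_2) : {fraction {poly C}} :=
  twisted_alexander torus_phi rho k.

End TorusKnot.

Definition algebraic_integer (C : fieldType) (z : C) : Prop :=
  integralOver (intr : int -> C) z.

(* Main.v *)
(* Let X = rho(x) and Y = rho(y). By Schur's lemma the central element
   x^p = y^q acts by a scalar z, and z^n = 1. Fox calculus gives, up to sign,
     Delta = (z t^(pq) - 1)^n / (det(t^q X - 1) det(t^p Y - 1)).
   The roots s of z t^(pq) - 1 are simple and are roots of unity. The
   multiplicity of s in the denominator is dim ker(X - s^-q) +
   dim ker(Y - s^-p), which is at most n because a common eigenvector of X and
   Y would span an invariant line. Hence Delta is a product of factors t - s.
   Moreover Delta depends only on the spectra of X and Y, which are recovered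
   from the traces of the powers of X and Y. Being sums of n roots of unity of
   bounded order, these traces take finitely many values on irreducible
   characters, so they are locally constant. *)
Require Import Defs.
From HB Require Import structures.
From mathcomp Require Import all_boot all_order all_algebra all_field.
From mathcomp Require Import boolp classical_sets reals topology normedtype.
From mathcomp.real_closed Require Import complex.
From mathcomp Require mpoly.

Set Implicit Arguments.
Unset Strict Implicit.
Unset Printing Implicit Defensive.

Import Order.TTheory GRing.Theory Num.Theory.
Import numFieldNormedType.Exports.
Local Open Scope ring_scope.
Local Open Scope classical_set_scope.
Local Open Scope complex_scope.

(** * Matrices with a scalar power *)

(** The polynomial is coprime to its derivative: [-m (X^m - c) + X (m X^(m-1))] is the constant
    [m c], nonzero in characteristic zero. Hence its roots are simple. *)
Lemma Xn_subC_split (C : numClosedFieldType) m (c : C) :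
  (0 < m)%N -> c != 0 ->
  exists2 s : seq C, uniq s & 'X^m - c%:P = \prod_(x <- s) ('X - x%:P).
Proof.
move=> m_gt0 c_neq0; have [s] := closed_field_poly_normal ('X^m - c%:P).
rewrite lead_coefXnsubC // scale1r => sE; exists s => //.
rewrite -separable_prod_XsubC -sE unlock derivB derivXn derivC subr0.
apply/Bezout_coprimepP; exists (- (m%:R : C)%:P, 'X : {poly C}) => /=.
have -> : - (m%:R)%:P * ('X^m - c%:P) + 'X * ('X^(m.-1) *+ m) = (c *+ m)%:P.
  rewrite mulrnAr -exprS prednK // mulrBr !mulNr opprK polyC_natr mulr_natl.
  by rewrite mulr_natl addrAC addNr add0r polyCMn.
rewrite polyC_eqp1 -mulr_natr mulf_neq0 // pnatr_eq0 -lt0n //.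
Qed.

(** The minimal polynomial of [A] divides [X^m - c], whose roots are simple. *)
Lemma diagonalizable_root_scalar (C : numClosedFieldType) n (A : 'M[C]_n)
    m (c : C) :
  (0 < m)%N -> c != 0 -> A ^+ m = c%:M -> diagonalizable A.
Proof.
case: n A => [|n] A m_gt0 c_neq0 Am.
  by rewrite (flatmx0 A); apply: diagonalizable0.
apply/diagonalizableP; have [s s_uniq sE] := Xn_subC_split m_gt0 c_neq0.
exists s => //; rewrite -sE; apply: mxminpoly_min.
by rewrite rmorphB rmorphXn /= horner_mx_X horner_mx_C Am subrr.
Qed.

Lemma diag_mxX (C : pzRingType) n (d : 'rV[C]_n) k :
  diag_mx d ^+ k = diag_mx (\row_i d 0 i ^+ k).
Proof.
elim: k => [|k IHk].
  rewrite expr0; apply/matrixP => i j; rewrite !mxE expr0 //.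
rewrite exprS IHk -[_ * _]/(_ *m _) mulmx_diag; congr diag_mx.
by apply/rowP=> i; rewrite !mxE exprS.
Qed.

Lemma conjmx_intertwineX (C : pzRingType) n (P A D : 'M[C]_n) k :
  P *m A = D *m P -> P *m A ^+ k = D ^+ k *m P.
Proof.
move=> PA; elim: k => [|k IHk]; first by rewrite !expr0 mulmx1 mul1mx.
by rewrite !exprSr -![_ * _]/(_ *m _) mulmxA IHk -!mulmxA PA.
Qed.

Lemma mxtrace_similar (C : comUnitRingType) n (P A D : 'M[C]_n) :
  P \in unitmx -> P *m A = D *m P -> \tr A = \tr D.
Proof.
move=> Pu PA; rewrite -[A](mulKmx Pu) PA mulmxA mxtrace_mulC mulmxA.
by rewrite mulmxV // mul1mx.
Qed.

Lemma det_similar (C : comUnitRingType) n (P A D : 'M[C]_n) :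
  P \in unitmx -> P *m A = D *m P -> \det A = \det D.
Proof.
rewrite unitmxE => Pu /(congr1 determinant); rewrite !det_mulmx mulrC.
exact: (mulIr Pu).
Qed.

(** The rows of [P] at the indices [i] with [d 0 i = a] are independent left eigenvectors of [A] for
    [a]. *)
Lemma count_eigenspace (C : fieldType) n (P A : 'M[C]_n) (d : 'rV[C]_n) a :
  P \in unitmx -> P *m A = diag_mx d *m P ->
  (#|[pred i | d 0%R i == a]| <= \rank (eigenspace A a))%N.
Proof.
move=> Pu PA; set I := [pred i | _].
pose f (j : 'I_#|I|) := enum_val j.
have f_inj : injective f by apply: enum_val_inj.
have rkP : \rank (rowsub f P) = #|I|.
  have -> : rowsub f P = rowsub f 1%:M *m P by rewrite mul_rowsub_mx mul1mx.
  rewrite mxrankMfree ?row_free_unit //; apply/eqP.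
  (* Since [f] is injective, the selected rows of the identity have their transpose as a right
     inverse, hence full rank. *)
  have eq1 : rowsub f 1%:M *m (rowsub f (1%:M : 'M[C]_n))^T = 1%:M.
    apply/matrixP => i j; rewrite !mxE (bigD1 (f i)) //= big1 ?addr0.
      by rewrite !mxE eqxx mul1r (inj_eq f_inj) eq_sym.
    by move=> k /negPf ki; rewrite !mxE eq_sym ki mul0r.
  by rewrite eqn_leq rank_leq_row -{1}(mxrank1 C #|I|) -eq1 mxrankM_maxl.
rewrite -rkP mxrankS //; apply/eigenspaceP; apply/row_matrixP => i.
rewrite mul_rowsub_mx PA !row_rowsub row_mul row_diag_mx linearZ /= row_rowsub.
by rewrite -scalemxAl -rowE; have := enum_valP i; rewrite inE => /eqP ->.
Qed.

(** Here [s] is the diagonal of a diagonalization of [A]. The morphism [f] serves to compute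
    determinants over [C(t)]: it will be the embedding of constants, and [u] a power of [t]. *)
Lemma spectrum_root_scalar (C : numClosedFieldType) (K : comUnitRingType)
    (f : {rmorphism C -> K}) n (A : 'M[C]_n) m (c : C) :
  (0 < m)%N -> c != 0 -> A ^+ m = c%:M ->
  exists s : seq C,
    [/\ size s = n, {in s, forall a, a ^+ m = c},
        forall k, \tr (A ^+ k) = \sum_(a <- s) a ^+ k,
        forall u, \det (u *: map_mx f A - 1%:M) = \prod_(a <- s) (u * f a - 1) &
        \det A = \prod_(a <- s) a /\
        forall a, (count_mem a s <= \rank (eigenspace A a))%N].
Proof.
move=> m_gt0 c_neq0 Am.
have [P Pu /(similar_diagLR Pu)[d dE]] :=
  diagonalizable_root_scalar m_gt0 c_neq0 Am.
have PA : P *m A = diag_mx d *m P.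
  by rewrite dE conjVmx // !mulmxA mulmxV // mul1mx.
exists [seq d 0 i | i <- enum 'I_n]; split.
- by rewrite size_map size_enum_ord.
(* Conjugating [A^m = c] shows that the [m]-th power of the diagonal matrix is [c] as well. *)
- have := conjmx_intertwineX m PA.
  rewrite Am scalar_mxC diag_mxX => /(can_inj (mulmxK Pu)) dm _ /mapP[i _ ->].
  by have /matrixP/(_ i i) := dm; rewrite !mxE eqxx.
- move=> k; rewrite (mxtrace_similar Pu (conjmx_intertwineX k PA)).
  rewrite diag_mxX mxtrace_diag big_map big_enum /=.
  by apply: eq_bigr => i _; rewrite mxE.
- move=> u; have Pfu : map_mx f P \in unitmx.
    by rewrite unitmxE det_map_mx rmorph_unit // -unitmxE.
  rewrite (@det_similar _ _ _ _ (diag_mx (\row_i (u * f (d 0 i) - 1))) Pfu).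
    rewrite det_diag big_map big_enum /=.
    by apply: eq_bigr => i _; rewrite mxE.
  rewrite mulmxBr mulmx1 -scalemxAr -map_mxM PA map_mxM scalemxAl /= map_diag_mx.
  rewrite -{2}[map_mx f P]mul1mx -mulmxBl; congr (_ *m _).
  apply/matrixP => i j; rewrite !mxE; case: eqP => // _; rewrite ?mulr1n //.
  by rewrite !mulr0n mulr0 subr0.
- split=> [|a].
    rewrite (det_similar Pu PA) det_diag big_map big_enum //.
  apply: leq_trans (count_eigenspace a Pu PA).
  rewrite count_map -size_filter cardE /enum_mem -filter_predI.
  apply: eq_leq; congr size; apply: eq_filter => i.
  by rewrite /= !inE andbT.
Qed.

(** * Products of cyclotomic factors and power sums *)

Section IntegralPolynomials.
Variable C : fieldType.

Definition integral_coefs (P : {poly C}) := forall i, algebraic_integer P`_i.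

Lemma integral_coefsC (c : C) : algebraic_integer c -> integral_coefs c%:P.
Proof. by move=> cI i; rewrite coefC; case: eqP => // _; exact: integral0. Qed.

Lemma integral_coefsM P Q :
  integral_coefs P -> integral_coefs Q -> integral_coefs (P * Q).
Proof.
move=> PI QI i; rewrite coefM.
elim/big_ind: _ => [|u v|j _]; [exact: integral0|exact: integral_add|].
by apply: integral_mul; [exact: PI | exact: QI].
Qed.

Lemma integral_coefsX P m : integral_coefs P -> integral_coefs (P ^+ m).
Proof.
move=> PI; elim: m => [|m IHm]; last by rewrite exprS; exact: integral_coefsM.
by rewrite expr0; apply: integral_coefsC; exact: integral1.
Qed.

Lemma integral_XsubC (c : C) : algebraic_integer c -> integral_coefs ('X - c%:P).
Proof.
move=> cI i; rewrite coefB coefX; apply: integral_sub; last exact: integral_coefsC.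
exact: integral_nat.
Qed.

Lemma algebraic_integer_unity (s : C) m :
  (0 < m)%N -> s ^+ m = 1 -> algebraic_integer s.
Proof.
move=> m_gt0 sm; exists ('X^m - 1); first exact: monicXnsubC.
by rewrite /root rmorphB rmorph1 /= map_polyXn !hornerE sm subrr.
Qed.

End IntegralPolynomials.

Section TorusPolynomials.
Variables (C : numClosedFieldType) (p q n : nat).
Hypotheses (p_gt0 : (0 < p)%N) (q_gt0 : (0 < q)%N).

(** The roots of [a X^k - 1] are simple and are the [s] with [s^k = a^-1]. Each satisfies
    [s^(m k) = a^-m = z^-1], so it is already listed in [S]. *)
Lemma scale_Xn_sub1_split (S : seq C) (z a : C) (k m : nat) :
  (0 < k)%N -> a != 0 -> a ^+ m = z ->
  uniq S -> 'X^(m * k) - (z^-1)%:P = \prod_(s <- S) ('X - s%:P) ->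
  a *: 'X^k - 1 = a *: \prod_(s <- S | a == s ^- k) ('X - s%:P).
Proof.
move=> k_gt0 a_neq0 am Suniq SE.
have SP s : (s \in S) = (s ^+ (m * k) == z^-1).
  by rewrite -root_prod_XsubC -SE rootE !hornerE subr_eq0.
have ai_neq0 : a^-1 != 0 by rewrite invr_eq0.
have [T Tuniq TE] := Xn_subC_split k_gt0 ai_neq0.
have TP s : (s \in T) = (s ^+ k == a^-1).
  by rewrite -root_prod_XsubC -TE rootE !hornerE subr_eq0.
have -> : a *: 'X^k - 1 = a *: ('X^k - (a^-1)%:P).
  by rewrite scalerBr -[a *: _%:P]mul_polyC -polyCM divff.
rewrite TE; congr (_ *: _); rewrite -[RHS]big_filter; apply: perm_big.
apply: uniq_perm; rewrite ?filter_uniq // => s.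
rewrite mem_filter TP SP [a == _]eq_sym -[X in _ = X && _](inj_eq invr_inj) invrK.
by case: eqP => //= sa; rewrite mulnC exprM sa exprVn am eqxx.
Qed.

(** After exchanging the two products, [X - s] occurs once for every entry of [A] equal to
    [s^-k]. *)
Lemma prod_scale_Xn_sub1 (S A : seq C) (z : C) (k m : nat) :
  (0 < k)%N -> z != 0 -> (0 < m)%N -> {in A, forall a, a ^+ m = z} ->
  uniq S -> 'X^(m * k) - (z^-1)%:P = \prod_(s <- S) ('X - s%:P) ->
  \prod_(a <- A) (a *: 'X^k - 1) =
  (\prod_(a <- A) a) *: \prod_(s <- S) ('X - s%:P) ^+ count_mem (s ^- k) A.
Proof.
move=> k_gt0 z_neq0 m_gt0 Az Suniq SE.
transitivity (\prod_(a <- A) (a *: \prod_(s <- S | a == s ^- k) ('X - s%:P))).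
  apply: eq_big_seq => a aA; apply: scale_Xn_sub1_split (Az a aA) Suniq SE => //.
  by apply: contra z_neq0 => /eqP a0; rewrite -(Az a aA) a0 expr0n gtn_eqF.
rewrite scaler_prod; congr (_ *: _).
rewrite (eq_bigr _ (fun a _ => big_mkcond _ _)) exchange_big /=.
apply: eq_bigr => s _; rewrite -big_mkcond /= big_const_seq iter_mulr_1.
by congr (_ ^+ _); apply: eq_count => a.
Qed.

(** All three products factor over the same list [S] of roots of [X^(pq) - z^-1], with leading
    coefficients [z^n], [\prod a] and [\prod b], all equal to [1]. Divisibility thus reduces to
    comparing exponents root by root. *)
Lemma torus_quotient (z : C) (A B : seq C) :
  (0 < n)%N -> z ^+ n = 1 ->
  {in A, forall a, a ^+ p = z} -> {in B, forall b, b ^+ q = z} ->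
  \prod_(a <- A) a = 1 -> \prod_(b <- B) b = 1 ->
  (forall a b, count_mem a A + count_mem b B <= n)%N ->
  exists2 Q : {poly C}, integral_coefs Q &
    (z *: 'X^(p * q) - 1) ^+ n =
    Q * (\prod_(a <- A) (a *: 'X^q - 1) * \prod_(b <- B) (b *: 'X^p - 1)).
Proof.
move=> n_gt0 zn Az Bz A1 B1 AB.
have z_neq0 : z != 0.
  by apply/eqP => z0; move/eqP: zn; rewrite z0 expr0n gtn_eqF // eq_sym oner_eq0.
have zi_neq0 : z^-1 != 0 by rewrite invr_eq0.
have pq_gt0 : (0 < p * q)%N by rewrite muln_gt0 p_gt0.
have [S Suniq SE] := Xn_subC_split pq_gt0 zi_neq0.
have qpE : 'X^(q * p) - (z^-1)%:P = \prod_(s <- S) ('X - s%:P) by rewrite mulnC.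
rewrite (prod_scale_Xn_sub1 q_gt0 z_neq0 p_gt0 Az Suniq SE).
rewrite (prod_scale_Xn_sub1 p_gt0 z_neq0 q_gt0 Bz Suniq qpE) A1 B1 !scale1r.
(* The exponent is what remains of [n] after the multiplicity of [s] in the denominator; by [AB] the
   subtraction does not truncate. *)
exists (\prod_(s <- S) ('X - s%:P)
          ^+ (n - (count_mem (s ^- q) A + count_mem (s ^- p) B))).
  rewrite big_seq; elim/big_ind: _ => [|P Q|s sS].
  - by apply: integral_coefsC; exact: integral1.
  - exact: integral_coefsM.
  apply/integral_coefsX/integral_XsubC.
  (* From [s^(pq) = z^-1] and [z^n = 1] follows [s^(pqn) = 1]. *)
  apply: (@algebraic_integer_unity _ _ (p * q * n)); first by rewrite muln_gt0 pq_gt0.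
  move: sS; rewrite -root_prod_XsubC -SE rootE !hornerE subr_eq0 => /eqP spq.
  by rewrite exprM spq exprVn zn invr1.
have -> : z *: 'X^(p * q) - 1 = z *: ('X^(p * q) - (z^-1)%:P).
  by rewrite scalerBr -[z *: _%:P]mul_polyC -polyCM divff.
rewrite exprZn zn scale1r SE -!big_split /= -prodrXl.
by apply: eq_bigr => s _; rewrite -!exprD subnK.
Qed.

End TorusPolynomials.

Lemma sum_unity_root (C : numFieldType) N (w : C) :
  w ^+ N = 1 -> \sum_(k < N) w ^+ k = if w == 1 then N%:R else 0.
Proof.
move=> wN; have [->|w_neq1] := eqVneq w 1.
  by rewrite (eq_bigr (fun=> 1)) ?sumr_const ?card_ord // => k _; rewrite expr1n.
have /eqP := subrX1 w N; rewrite wN subrr eq_sym mulf_eq0 subr_eq0.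
by rewrite (negPf w_neq1) => /eqP.
Qed.

(* Fourier inversion on the group of N-th roots of unity. *)
Lemma sum_power_sums (C : numFieldType) N (s : seq C) (b : C) :
  b ^+ N = 1 -> {in s, forall a, a ^+ N = 1} ->
  \sum_(k < N) b ^- k * \sum_(a <- s) a ^+ k = N%:R * (count_mem b s)%:R.
Proof.
move=> bN sN; have [->|N_gt0] := posnP N; first by rewrite big_ord0 mul0r.
have b_neq0 : b != 0.
  by apply/eqP => b0; move/eqP: bN; rewrite b0 expr0n gtn_eqF // eq_sym oner_eq0.
rewrite (eq_bigr _ (fun k _ => mulr_sumr _ _ _ _)) exchange_big /=.
transitivity (\sum_(a <- s) (if a == b then N%:R else 0 : C)).
  apply: eq_big_seq => a aS.
  have abN : (a / b) ^+ N = 1 by rewrite expr_div_n bN sN // divr1.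
  rewrite -(inj_eq (mulIf (invr_neq0 b_neq0))) divff // -(sum_unity_root abN).
  by apply: eq_bigr => k _; rewrite expr_div_n mulrC.
by rewrite -big_mkcond big_const_seq iter_addr_0 -[LHS]mulr_natr.
Qed.

(** By [sum_power_sums] the first [N] power sums determine the multiplicity of every [N]-th root of
    unity, as [N] is invertible in characteristic zero. *)
Lemma perm_eq_power_sums (C : numFieldType) N (s t : seq C) :
  (0 < N)%N -> {in s, forall a, a ^+ N = 1} -> {in t, forall a, a ^+ N = 1} ->
  (forall k, (k < N)%N -> \sum_(a <- s) a ^+ k = \sum_(a <- t) a ^+ k) ->
  perm_eq s t.
Proof.
move=> N_gt0 sN tN eq_st; apply/allP => b; rewrite mem_cat => b_st /=.
have bN : b ^+ N = 1 by case/orP: b_st => [/sN|/tN].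
rewrite -(eqr_nat C); apply/eqP/(@mulfI _ N%:R); first by rewrite pnatr_eq0 -lt0n.
rewrite -!sum_power_sums //; apply: eq_bigr => k _.
by rewrite eq_st.
Qed.

(** With [W] a list of roots of unity, this confines traces to a finite set. *)
Lemma finite_sums (C : nzRingType) (W : seq C) n :
  exists T : seq C, forall s, size s = n -> {subset s <= W} ->
    \sum_(a <- s) a \in T.
Proof.
elim: n => [|n [T HT]].
  by exists [:: 0] => s /size0nil -> _; rewrite big_nil inE.
exists [seq a + b | a <- W, b <- T] => -[|a s] //= [sn] sW.
rewrite big_cons; apply: allpairs_f; first by apply: sW; rewrite inE eqxx.
by apply: HT => // b bs; apply: sW; rewrite inE bs orbT.
Qed.

(** * Fox calculus *)

Lemma det_castmx (K : comPzRingType) m n (e : m = n) (A : 'M[K]_m) :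
  \det (castmx (e, e) A) = \det A.
Proof. by case: n / e. Qed.

(** With two generators and one relator a single block remains, but its size is written as a sum
    over ['I_1], hence the cast. *)
Lemma det_mxblock1 (K : comPzRingType) n (B : 'I_1 -> 'I_1 -> 'M[K]_n) :
  \det (\mxblock_(i < 1, j < 1) B i j) = \det (B ord0 ord0).
Proof.
rewrite [B ord0 ord0]mxEmxblock det_castmx.
congr (\det _); apply/eq_mxblockP => i j.
by rewrite (ord1 i) (ord1 j).
Qed.

(** Take determinants in [A^m - 1 = (A - 1) (1 + A + ... + A^(m-1))]. *)
Lemma det_geometric_ratio (K : fieldType) n (A B E : 'M[K]_n) m :
  E = A ^+ m -> \det (A - 1) != 0 ->
  \det (\sum_(i < m) A ^+ i) / \det (B - 1) =
  \det (E - 1) / (\det (A - 1) * \det (B - 1)).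
Proof. by move=> -> dA; rewrite subrX1 det_mulmx -mulf_div divff // mul1r. Qed.

Lemma det_geometric_ratioN (K : fieldType) n (A B E : 'M[K]_n) m :
  E = A ^+ m -> \det (A - 1) != 0 ->
  \det (- \sum_(i < m) A ^+ i) / \det (B - 1) =
  (-1) ^+ n * (\det (E - 1) / (\det (B - 1) * \det (A - 1))).
Proof.
move=> EA dA; rewrite -scaleN1r detZ -mulrA (det_geometric_ratio B EA dA).
by rewrite [\det (B - 1) * _]mulrC.
Qed.

Lemma ord2P (i : 'I_2) : i = ord0 \/ i = ord_max.
Proof. by case: i => -[|[|k]] // ?; [left|right]; exact/val_inj. Qed.

Lemma tvar_neq0 (C : fieldType) : tvar C != 0.
Proof. by rewrite /tvar tofrac_eq0 polyX_eq0. Qed.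

(** The embedding of constants is named so that it carries a ring morphism structure and can be
    passed to [spectrum_root_scalar]. *)
Definition const_frac (C : fieldType) : C -> {fraction {poly C}} :=
  @tofrac {poly C} \o polyC.
HB.instance Definition _ (C : fieldType) :=
  GRing.RMorphism.copy (@const_frac C) (@tofrac {poly C} \o polyC).

Section FoxCalculus.
Variables (C : fieldType) (l : nat) (r : 'I_l -> word l.+1).
Variables (phi : 'I_l.+1 -> int) (n : nat) (rho : sl_rep C (pres_group r) n).
Implicit Types (v w : word l.+1) (s : zword l.+1).

Local Notation K := {fraction {poly C}}.
Local Notation Phi_word := (Phi_word phi rho).
Local Notation Phi := (Phi phi rho).

Lemma Phi_wordE w :
  Phi_word w =
    tvar C ^ word_weight phi w *: map_mx (@const_frac C) (rho (word_class r w)).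
Proof. by []. Qed.

Lemma Phi_word_cat v w : Phi_word (v ++ w) = Phi_word v * Phi_word w.
Proof.
rewrite !Phi_wordE.
have -> : word_weight phi (v ++ w) = word_weight phi v + word_weight phi w.
  exact: big_cat.
rewrite expfzDr ?tvar_neq0 // -[word_class r (v ++ w)](pres_mulE r) (repM rho).
rewrite map_mxM -scalerA scalemxAr scalemxAl.
reflexivity.
Qed.

Lemma Phi_word_nil : Phi_word [::] = 1.
Proof.
rewrite Phi_wordE /word_weight big_nil expr0z scale1r.
have -> : rho (word_class r [::]) = 1%:M := rep1 rho.
by rewrite map_mx1.
Qed.

Lemma Phi_cat s s' : Phi (s ++ s') = Phi s + Phi s'.
Proof. exact: big_cat. Qed.

Lemma Phi_shift w s :
  Phi [seq (u.1, w ++ u.2) | u <- s] = Phi_word w * Phi s.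
Proof.
rewrite /Phi big_map mulr_sumr; apply: eq_bigr => u _ /=.
by rewrite Phi_word_cat mulrzAr.
Qed.

(** The Fox product rule [d(vw) = dv + v dw], seen through [Phi]; since [fox] peels off one letter
    at a time, it follows by induction on [v]. *)
Lemma Phi_fox_cat j v w :
  Phi (fox j (v ++ w)) = Phi (fox j v) + Phi_word v * Phi (fox j w).
Proof.
elim: v => [|a v IHv] /=.
  by rewrite Phi_word_nil mul1r {2}/Phi big_nil add0r.
rewrite !Phi_cat -addrA; congr (_ + _).
rewrite !(Phi_shift [:: a]) -(cat1s a v) Phi_word_cat.
by rewrite IHv mulrDr mulrA.
Qed.

Lemma Phi_fox_gen j : Phi (fox j [:: (j, true)]) = 1.
Proof. by rewrite /= eqxx /Phi big_seq1 Phi_word_nil. Qed.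

Lemma Phi_fox_gen_neq i j b : i != j -> Phi (fox j [:: (i, b)]) = 0.
Proof. by move=> /negPf ij; rewrite /= ij /Phi big_nil. Qed.

Lemma Phi_gen_invr j : Phi_word [:: (j, true)] * Phi_word [:: (j, false)] = 1.
Proof.
rewrite -Phi_word_cat -Phi_word_nil /Phi_word /word_weight.
rewrite !big_cons big_nil addr0 subrr; congr (_ *: map_mx _ (rho _)).
exact/word_class_eq/pres_cancel.
Qed.

Lemma Phi_fox_inv j : Phi (fox j [:: (j, false)]) = - Phi_word [:: (j, false)].
Proof. by rewrite /= eqxx /Phi big_seq1. Qed.

Lemma Phi_word_nseq a m : Phi_word (nseq m a) = Phi_word [:: a] ^+ m.
Proof.
elim: m => [|m IHm]; first exact: Phi_word_nil.
by rewrite -[nseq _ _]/([:: a] ++ nseq m a) Phi_word_cat IHm exprS.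
Qed.

Lemma Phi_fox_nseq_neq i j b m : i != j -> Phi (fox j (nseq m (i, b))) = 0.
Proof.
move=> ij; elim: m => [|m IHm]; first by rewrite /Phi big_nil.
rewrite -[nseq _ _]/([:: (i, b)] ++ nseq m (i, b)) Phi_fox_cat IHm.
by rewrite Phi_fox_gen_neq // mulr0 addr0.
Qed.

Lemma Phi_fox_nseq j m :
  Phi (fox j (nseq m (j, true))) = \sum_(i < m) Phi_word [:: (j, true)] ^+ i.
Proof.
elim: m => [|m IHm]; first by rewrite big_ord0 /Phi big_nil.
rewrite -[nseq _ _]/([:: (j, true)] ++ nseq m (j, true)) Phi_fox_cat IHm.
rewrite Phi_fox_gen big_ord_recl expr0 mulr_sumr; congr (_ + _).
by apply: eq_bigr => i _; rewrite -exprS.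
Qed.

(** The derivative of [x^-m] is [-(x^-1 + ... + x^-m)]; the factor [x^m] clears the inverses. *)
Lemma Phi_fox_nseqV j m :
  Phi_word [:: (j, true)] ^+ m * Phi (fox j (nseq m (j, false))) =
  - \sum_(i < m) Phi_word [:: (j, true)] ^+ i.
Proof.
elim: m => [|m IHm]; first by rewrite big_ord0 /Phi big_nil mulr0 oppr0.
rewrite -[nseq _ _]/([:: (j, false)] ++ nseq m (j, false)) Phi_fox_cat.
rewrite Phi_fox_inv exprSr mulrDr mulrN -!mulrA (mulrA _ (Phi_word _) (Phi _)).
by rewrite Phi_gen_invr mulr1 mul1r IHm big_ord_recr /= opprD addrC.
Qed.

Lemma Phi_gen_sub1 j : Phi (gen_sub1 j) = Phi_word [:: (j, true)] - 1.
Proof. by rewrite /Phi /gen_sub1 !big_cons big_nil addr0 Phi_word_nil. Qed.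

End FoxCalculus.

Section TorusFox.
Variables (C : fieldType) (p q n : nat) (rho : sl_rep C (torus_group p q) n).

Local Notation X := (Phi_word (torus_phi p q) rho [:: (ord0, true)]).
Local Notation Y := (Phi_word (torus_phi p q) rho [:: (ord_max, true)]).

(** The relator acts trivially under [rho] and has weight [p q - q p = 0], so [Phi_word] sends it to
    [1]. *)
Lemma Phi_torus_rel : X ^+ p = Y ^+ q.
Proof.
have YV m : Phi_word (torus_phi p q) rho (nseq m (ord_max, false)) * Y ^+ m = 1.
  elim: m => [|m IHm]; first by rewrite Phi_word_nil expr0 mulr1.
  rewrite -[nseq _ _]/([:: (ord_max, false)] ++ nseq m (ord_max, false)).
  rewrite Phi_word_cat exprSr mulrA -[_ * _ * Y ^+ m]mulrA IHm mulr1.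
  exact/mulmx1C/Phi_gen_invr.
rewrite -[LHS]mulr1 -(YV q) -Phi_word_nseq mulrA -Phi_word_cat.
suff -> : Phi_word (torus_phi p q) rho (torus_rel p q ord0) = 1.
  by rewrite mul1r.
rewrite -(Phi_word_nil (torus_phi p q) rho) /Phi_word.
have -> : word_class (torus_rel p q) (torus_rel p q ord0) =
    word_class (torus_rel p q) [::].
  exact/word_class_eq/(pres_rel _ ord0).
congr (_ ^ _ *: _); rewrite /word_weight big_cat big_nil !big_nseq /= !iter_addr_0.
by rewrite /torus_phi /= mulNrn -(natz q) -(natz p) -!mulrnA mulnC subrr.
Qed.

Lemma det_alexander_max :
  \det (alexander_mx (torus_phi p q) rho ord_max) = \det (\sum_(i < p) X ^+ i).
Proof.
rewrite det_mxblock1 /torus_rel (_ : lift ord_max ord0 = ord0); last exact/val_inj.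
by rewrite Phi_fox_cat Phi_fox_nseq Phi_fox_nseq_neq // mulr0 addr0.
Qed.

(** The derivative of the relator in [y] is [x^p] times that of [y^-q]; replacing [X^p] by [Y^q]
    makes [Phi_fox_nseqV] applicable. *)
Lemma det_alexander_0 :
  \det (alexander_mx (torus_phi p q) rho ord0) = \det (- \sum_(i < q) Y ^+ i).
Proof.
rewrite det_mxblock1 /torus_rel (_ : lift ord0 ord0 = ord_max); last exact/val_inj.
rewrite Phi_fox_cat Phi_fox_nseq_neq // add0r Phi_word_nseq Phi_torus_rel.
by rewrite Phi_fox_nseqV.
Qed.

(** Both choices of deleted column lead to one fraction, up to the sign [(-1)^n] contributed by the
    derivative in [y]. *)
Lemma torus_alexanderE k (f g h : {fraction {poly C}}) :
  \det (X ^+ p - 1) = f -> \det (X - 1) = g -> \det (Y - 1) = h ->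
  g != 0 -> h != 0 ->
  torus_alexander rho k = (-1) ^+ (n * (k == ord0)) * (f / (g * h)).
Proof.
move=> <- <- <- dX dY; case: (ord2P k) => ->.
  rewrite /torus_alexander /twisted_alexander det_alexander_0 Phi_gen_sub1.
  rewrite muln1; exact: (det_geometric_ratioN X Phi_torus_rel dY).
rewrite /torus_alexander /twisted_alexander det_alexander_max Phi_gen_sub1.
rewrite muln0 expr0 mul1r; exact: (det_geometric_ratio Y erefl dX).
Qed.

End TorusFox.

(** * Irreducible representations of torus knot groups *)

Section PresentedGroupTheory.
Variables (l m : nat) (r : 'I_m -> word l).
Local Notation G := (pres_group r).

Definition gen (i : 'I_l) : G := word_class r [:: (i, true)].

Lemma pres_group_ind (P : G -> Prop) :
  P 1%g -> (forall g h, P g -> P h -> P (g * h)%g) ->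
  (forall g, P g -> P g^-1%g) -> (forall i, P (gen i)) -> forall g, P g.
Proof.
move=> P1 PM PV Pgen g; rewrite -(word_class_repr g).
elim: (repr _) => [|[i b] w IHw]; first exact: P1.
rewrite -[_ :: w]/([:: (i, b)] ++ w) -(pres_mulE r); apply: PM IHw.
case: b; first exact: Pgen.
suff -> : word_class r [:: (i, false)] = (gen i)^-1%g by apply: PV.
by rewrite -[_^-1%g]/(pres_inv _) pres_invE.
Qed.

Lemma word_class_nseq i k : word_class r (nseq k (i, true)) = (gen i ^+ k)%g.
Proof.
elim: k => [|k IHk]; first by rewrite expg0.
rewrite expgS -IHk; exact/esym/(pres_mulE r).
Qed.

End PresentedGroupTheory.

(** Insert [y^-q y^q] after [x^p] and cancel the relator [x^p y^-q]. *)
Lemma torus_relation p q :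
  (gen (torus_rel p q) ord0 ^+ p = gen (torus_rel p q) ord_max ^+ q)%g.
Proof.
rewrite -!word_class_nseq; apply/word_class_eq.
set v := nseq p _; set w := nseq q _.
have wV : winv w = nseq q (ord_max, false) by rewrite /winv map_nseq rev_nseq.
rewrite -[X in pres_eq _ X _]cats0; apply: pres_trans (pres_cat (pres_refl _ v) _) _.
  exact/pres_sym/(pres_eq_winvl _ w).
rewrite wV catA -[X in pres_eq _ _ X]cat0s; apply: pres_cat (pres_refl _ w).
exact: (pres_rel _ ord0).
Qed.

Section RepresentationTheory.
Variables (C : fieldType) (G : groupType) (n : nat) (rho : sl_rep C G n).

Lemma repX g k : rho (g ^+ k)%g = rho g ^+ k.
Proof.
elim: k => [|k IHk]; first by rewrite expg0 expr0 (rep1 rho).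
by rewrite expgS exprS (repM rho) IHk.
Qed.

Lemma repVl g : rho g^-1%g *m rho g = 1%:M.
Proof. by rewrite -(repM rho) mulVg (rep1 rho). Qed.

Lemma rep_comm g h : commute g h -> comm_mx (rho g) (rho h).
Proof. by rewrite /comm_mx -!(repM rho) => ->. Qed.

End RepresentationTheory.

Lemma comm_trmx (C : comPzSemiRingType) n (A B : 'M[C]_n) :
  comm_mx A B -> comm_mx A^T B^T.
Proof. by rewrite /comm_mx -!trmx_mul => ->. Qed.

(** An eigenspace of [A^T] is nonzero and stable under every [(rho g)^T], hence is the whole space.
    Transposes appear because irreducibility is phrased with row spaces. *)
Lemma schur (C : numClosedFieldType) (G : groupType) n (rho : sl_rep C G n)
    (A : 'M[C]_n) :
  irreducible_rep rho -> (forall g, comm_mx A (rho g)) -> exists c, A = c%:M.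
Proof.
move=> [n_gt0 irr] Acomm; have [c] := eigenvalue_closed A^T n_gt0.
rewrite /eigenvalue -mxrank_eq0 => Ec; exists c.
have [|E0|/eqP Efull] := irr (eigenspace A^T c).
- by move=> g; apply/comm_mx_stable_eigenspace/comm_trmx.
- by rewrite E0 in Ec.
apply: trmx_inj; rewrite tr_scalar_mx -scalemx1 -[A^T]mul1mx.
by apply/eigenspaceP; rewrite sub1mx.
Qed.

(** Links the transposed matrices of [irreducible_rep] with the eigenspaces that bound
    multiplicities in [spectrum_root_scalar]. *)
Lemma rank_eigenspace_tr (C : fieldType) n (A : 'M[C]_n) a :
  \rank (eigenspace A^T a) = \rank (eigenspace A a).
Proof.
by rewrite !mxrank_ker -{1}tr_scalar_mx -linearB /= mxrank_tr.
Qed.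

Section TorusReps.
Variables (C : numClosedFieldType) (p q n : nat).
Variable rho : sl_rep C (torus_group p q) n.
Hypothesis rho_irr : irreducible_rep rho.

Local Notation x := (gen (torus_rel p q) ord0).
Local Notation y := (gen (torus_rel p q) ord_max).

Lemma torus_central (g : torus_group p q) : commute (x ^+ p)%g g.
Proof.
elim/pres_group_ind: g => [|g h|g|i].
- exact: commute1.
- exact: commuteM.
- exact: commuteV.
by case: (ord2P i) => ->; [|rewrite torus_relation]; apply/commute_sym/commuteX.
Qed.

Lemma torus_irr_central :
  exists z, [/\ z ^+ n = 1, rho x ^+ p = z%:M & rho y ^+ q = z%:M].
Proof.
have [g|z zE] := schur (A := rho (x ^+ p)%g) rho_irr.
  exact/rep_comm/torus_central.
exists z; rewrite -!repX -torus_relation zE; split=> //.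
by rewrite -det_scalar -zE (rep_det rho).
Qed.

(** The two eigenspaces meet only in [0]: a common eigenvector of the two generators would span an
    invariant line, of rank [1], which is neither [0] nor [n]. *)
Lemma torus_irr_eigenspaces a b : (2 <= n)%N ->
  (\rank (eigenspace (rho x) a) + \rank (eigenspace (rho y) b) <= n)%N.
Proof.
move=> n_ge2; rewrite -(rank_eigenspace_tr (rho x)) -(rank_eigenspace_tr (rho y)).
rewrite -mxrank_sum_cap.
set E := eigenspace _ a; set F := eigenspace _ b.
have [->|] := eqVneq (E :&: F)%MS 0; first by rewrite mxrank0 addn0 rank_leq_row.
rewrite -nz_row_eq0; set u := nz_row _ => u_neq0; exfalso.
have uEF : (u <= E :&: F)%MS by exact: nz_row_sub.
have [_ /(_ <<u>>%MS) irr] := rho_irr; move: irr.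
rewrite genmxE rank_rV u_neq0 => -[g|//|n1]; last by rewrite -n1 in n_ge2.
suff [c uc] : exists c, u *m (rho g)^T = c *: u.
  by rewrite (eqmx_stable _ (genmxE u)) uc scalemx_sub.
(* The elements having [u] as an eigenvector are closed under products and inverses, so the
   generators suffice. *)
elim/pres_group_ind: g => [|g h [c uc] [d ud]|g [c uc]|i].
- by exists 1; rewrite (rep1 rho) trmx1 mulmx1 scale1r.
- exists (d * c); rewrite (repM rho) trmx_mul mulmxA ud -scalemxAl uc.
  by rewrite scalerA.
- have uK : u *m (rho g)^T *m (rho g^-1%g)^T = u.
    by rewrite -mulmxA -trmx_mul repVl trmx1 mulmx1.
  have c_neq0 : c != 0.
    apply: contra u_neq0 => /eqP c0.
    by rewrite -uK uc c0 scale0r mul0mx.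
  by exists c^-1; rewrite -{2}uK uc -scalemxAl scalerA mulVf // scale1r.
case: (ord2P i) => ->; [exists a|exists b]; apply/eigenspaceP.
  exact: submx_trans uEF (capmxSl _ _).
exact: submx_trans uEF (capmxSr _ _).
Qed.

End TorusReps.

(** * Trace topology and local constancy *)

Lemma continuous_mul (K : numFieldType) (T : topologicalType) (f g : T -> K^o) :
  continuous f -> continuous g -> continuous (fun x => f x * g x : K^o).
Proof. by move=> f_cont g_cont x; exact: (cvgM (f_cont x) (g_cont x)). Qed.

Lemma continuous_prod (K : numFieldType) (T : topologicalType) I (r : seq I)
    (P : pred I) (f : I -> T -> K^o) :
  (forall i, P i -> continuous (f i)) ->
  continuous (fun x => \prod_(i <- r | P i) f i x : K^o).
Proof.
apply: continuous_big; apply: continuous_mul => -[a b].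
  exact: cvg_fst.
exact: cvg_snd.
Qed.

Lemma continuous_meval (K : numFieldType) N (P : mpoly.mpoly N K) :
  continuous (fun v : 'rV[K^o]_N => mpoly.meval (fun i => v ord0 i) P : K^o).
Proof.
rewrite (_ : (fun _ => _) = fun v : 'rV[K^o]_N => \sum_(m <- mpoly.msupp P)
    mpoly.mcoeff m P * \prod_i v ord0 i ^+ mpoly.fun_of_multinom m i); last first.
  by apply: funext => v; exact: mpoly.mevalE.
apply: continuous_big => [|m _]; first exact: add_continuous.
apply: continuous_mul; first exact: cst_continuous.
apply: continuous_prod => i _.
elim: (mpoly.fun_of_multinom m i) => [|k IHk]; first exact: cst_continuous.
rewrite (_ : (fun _ => _) = fun v : 'rV[K^o]_N => v ord0 i * v ord0 i ^+ k).
  by apply: continuous_mul IHk; exact: coord_continuous.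
by apply: funext => w; rewrite exprS.
Qed.

Section CharacterSeparation.
Variables (R : realType) (G : groupType) (n N : nat) (e : 'I_N -> G).

(** Among characters whose values on [gs] lie in the finite list [T], agreeing with [chi0] on [gs]
    is an open condition, cut out by the nonvanishing of one polynomial in the trace coordinates. *)
Lemma open_irr_chars_separating (gs : seq G) (T : seq R[i]) (chi0 : G -> R[i]) :
  trace_embedding R[i] G n N e -> irr_chars R[i] G n chi0 ->
  exists V : set (G -> R[i]),
    [/\ open_irr_chars n e V, V chi0 &
        forall chi, V chi -> {in gs, forall g, chi g \in T} ->
          {in gs, chi =1 chi0}].
Proof.
move=> emb chi0_irr; have [P PE] := choice emb.
pose ev g (v : 'rV[R[i]^o]_N) : R[i]^o := mpoly.meval (fun i => v ord0 i) (P g).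
have evE chi g : irr_chars R[i] G n chi -> ev g (trace_coords e chi) = chi g.
  move=> [rho _ ->]; rewrite /ev PE; congr (mpoly.meval _ _).
  by apply: funext => i; rewrite mxE.
(* [H] vanishes as soon as some [g] of [gs] takes a value of [T] other than [chi0 g], and it does
   not vanish at [chi0] itself. *)
pose H v : R[i]^o := \prod_(g <- gs) \prod_(w <- T | w != chi0 g) (ev g v - w).
have H_cont : continuous H.
  apply: continuous_prod => g _; apply: continuous_prod => w _ v.
  exact: (cvgB (@continuous_meval _ _ (P g) v) (cvg_cst (w : R[i]^o))).
exists (irr_chars R[i] G n `&` trace_coords e @^-1` (H @^-1` [set~ 0])); split.
- exists (H @^-1` [set~ 0]) => //; apply: open_comp => //.
  exact/closed_openC/accessible_closed_set1/hausdorff_accessible/norm_hausdorff.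
- split=> //=; apply/eqP; rewrite prodf_seq_neq0; apply/allP => g _ /=.
  rewrite prodf_seq_neq0; apply/allP => w _; apply/implyP.
  by rewrite evE // subr_eq0 eq_sym.
move=> chi [chi_irr /eqP] + chiT g g_gs.
rewrite prodf_seq_neq0 => /allP/(_ g g_gs) /=.
rewrite prodf_seq_neq0 => /allP/(_ _ (chiT g g_gs)) /=.
by rewrite evE // subrr eqxx implybF negbK => /eqP.
Qed.

End CharacterSeparation.

(** * The twisted Alexander polynomial as a function of the two spectra *)

Section TorusAlexander.
Variables (C : numClosedFieldType) (p q n : nat).
Hypotheses (p_gt0 : (0 < p)%N) (q_gt0 : (0 < q)%N) (n_ge2 : (2 <= n)%N).

Local Notation x := (gen (torus_rel p q) ord0).
Local Notation y := (gen (torus_rel p q) ord_max).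

Definition torus_fraction (z : C) (A B : seq C) : {fraction {poly C}} :=
  tofrac ((z *: 'X^(p * q) - 1) ^+ n) /
  (tofrac (\prod_(a <- A) (a *: 'X^q - 1)) *
   tofrac (\prod_(b <- B) (b *: 'X^p - 1))).

Lemma prod_scale_Xn_sub1_neq0 (A : seq C) k :
  (0 < k)%N -> \prod_(a <- A) (a *: 'X^k - 1) != 0.
Proof.
move=> k_gt0; rewrite prodf_seq_neq0; apply/allP => a _ /=.
(* Every factor takes the value [-1] at [0]. *)
apply/eqP => /(congr1 (horner^~ 0)) /eqP.
by rewrite !hornerE expr0n gtn_eqF // mulr0 sub0r oppr_eq0 oner_eq0.
Qed.

Lemma tofrac_prod_scale_Xn_sub1 (A : seq C) k :
  \prod_(a <- A) (tvar C ^+ k * const_frac a - 1) =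
  tofrac (\prod_(a <- A) (a *: 'X^k - 1)).
Proof.
rewrite rmorph_prod; apply: eq_bigr => a _.
by rewrite rmorphB rmorph1 -mul_polyC rmorphM rmorphXn /= mulrC.
Qed.

(* A and B list the eigenvalues of rho x and rho y with their multiplicities. *)
Record torus_spectra (rho : sl_rep C (torus_group p q) n) z (A B : seq C) :=
  TorusSpectra {
    spectra_z : z ^+ n = 1;
    spectra_sizex : size A = n;
    spectra_sizey : size B = n;
    spectra_x : {in A, forall a, a ^+ p = z};
    spectra_y : {in B, forall b, b ^+ q = z};
    spectra_detx : \prod_(a <- A) a = 1;
    spectra_dety : \prod_(b <- B) b = 1;
    spectra_count : forall a b, (count_mem a A + count_mem b B <= n)%N;
    spectra_trx : forall k, rep_char rho (x ^+ k)%g = \sum_(a <- A) a ^+ k;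
    spectra_try : forall k, rep_char rho (y ^+ k)%g = \sum_(b <- B) b ^+ k;
    spectra_alexander : forall k, torus_alexander rho k =
      (-1) ^+ (n * (k == ord0)) * torus_fraction z A B }.

Lemma torus_irr_spectra (rho : sl_rep C (torus_group p q) n) :
  irreducible_rep rho -> exists z A B, torus_spectra rho z A B.
Proof.
move=> irr; have [z [zn xz yz]] := torus_irr_central irr.
have n_gt0 : (0 < n)%N by exact: ltnW.
have z_neq0 : z != 0.
  by apply/eqP => z0; move/eqP: zn; rewrite z0 expr0n gtn_eqF // eq_sym oner_eq0.
have [A [Asz Az Atr Adet [A1 Acnt]]] :=
  spectrum_root_scalar (@const_frac C) p_gt0 z_neq0 xz.
have [B [Bsz Bz Btr Bdet [B1 Bcnt]]] :=
  spectrum_root_scalar (@const_frac C) q_gt0 z_neq0 yz.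
have dX : \det (Phi_word (torus_phi p q) rho [:: (ord0, true)] - 1) =
    tofrac (\prod_(a <- A) (a *: 'X^q - 1)).
  by rewrite -tofrac_prod_scale_Xn_sub1 -Adet Phi_wordE /word_weight big_seq1.
have dY : \det (Phi_word (torus_phi p q) rho [:: (ord_max, true)] - 1) =
    tofrac (\prod_(b <- B) (b *: 'X^p - 1)).
  by rewrite -tofrac_prod_scale_Xn_sub1 -Bdet Phi_wordE /word_weight big_seq1.
(* [X^p] is the scalar matrix [z t^(pq)], so this determinant is an [n]-th power. *)
have dXp : \det (Phi_word (torus_phi p q) rho [:: (ord0, true)] ^+ p - 1) =
    tofrac ((z *: 'X^(p * q) - 1) ^+ n).
  rewrite -Phi_word_nseq Phi_wordE word_class_nseq repX xz.
  have -> : word_weight (torus_phi p q) (nseq p (ord0, true)) = (q * p)%N.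
    by rewrite /word_weight big_nseq iter_addr_0 /torus_phi /= -(natz q) -mulrnA natz.
  rewrite map_scalar_mx scale_scalar_mx -[1]/(1%:M) -raddfB det_scalar /=.
  by rewrite tofracXn tofracB tofrac1 -mul_polyC tofracM tofracXn mulnC mulrC.
exists z, A, B; split=> //.
- by rewrite -A1 (rep_det rho).
- by rewrite -B1 (rep_det rho).
- move=> a b; apply: leq_trans (torus_irr_eigenspaces irr a b n_ge2).
  exact: leq_add.
- by move=> k; rewrite /rep_char repX.
- by move=> k; rewrite /rep_char repX.
by move=> k; apply: (torus_alexanderE k dXp dX dY);
  rewrite tofrac_eq0 prod_scale_Xn_sub1_neq0.
Qed.

Lemma torus_fraction_integral rho z A B : torus_spectra rho z A B ->
  exists2 Q : {poly C}, integral_coefs Q & torus_fraction z A B = tofrac Q.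
Proof.
move=> sp; have n_gt0 : (0 < n)%N by exact: ltnW.
have [Q QI QE] := torus_quotient p_gt0 q_gt0 n_gt0 (spectra_z sp) (spectra_x sp)
  (spectra_y sp) (spectra_detx sp) (spectra_dety sp) (spectra_count sp).
exists Q => //; rewrite /torus_fraction QE !tofracM mulfK //.
by rewrite mulf_neq0 // tofrac_eq0 prod_scale_Xn_sub1_neq0.
Qed.

Lemma torus_spectra_unity rho z A B : torus_spectra rho z A B ->
  {in A, forall a, a ^+ (p * q * n) = 1} /\
  {in B, forall b, b ^+ (p * q * n) = 1}.
Proof.
move=> sp; split=> [a /(spectra_x sp) az|b /(spectra_y sp) bz].
  by rewrite -mulnA exprM az mulnC exprM (spectra_z sp) expr1n.
by rewrite [(p * q)%N]mulnC -mulnA exprM bz mulnC exprM (spectra_z sp) expr1n.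
Qed.

(** Each trace is a sum of [n] roots of unity of order dividing [p q n], and powers of such roots
    are again of this kind; hence one [T] serves all [k]. *)
Lemma torus_traces_finite :
  exists T : seq C, forall rho z A B, torus_spectra rho z A B ->
    forall k, rep_char rho (x ^+ k)%g \in T /\ rep_char rho (y ^+ k)%g \in T.
Proof.
have m_gt0 : (0 < p * q * n)%N by rewrite !muln_gt0 p_gt0 q_gt0 ltnW.
have [W _ WE] := Xn_subC_split m_gt0 (oner_neq0 C).
have [T TE] := finite_sums W n.
have sumT (s : seq C) k : size s = n ->
    {in s, forall a, a ^+ (p * q * n) = 1} -> \sum_(a <- s) a ^+ k \in T.
  move=> s_sz sm; rewrite -(big_map (fun a => a ^+ k) xpredT id).
  rewrite TE ?size_map // => _ /mapP[a aS ->].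
  by rewrite -root_prod_XsubC -WE rootE !hornerE subr_eq0 exprAC sm // expr1n.
exists T => rho z A B sp k; have [Am Bm] := torus_spectra_unity sp.
rewrite (spectra_trx sp) (spectra_try sp).
by split; apply: sumT; rewrite ?(spectra_sizex sp) ?(spectra_sizey sp).
Qed.

(** Power sums determine [A] and [B] up to order; then [z] is the [p]-th power of any entry of [A],
    which is nonempty. *)
Lemma torus_fraction_traces rho rho' z z' A A' B B' :
  torus_spectra rho z A B -> torus_spectra rho' z' A' B' ->
  (forall k, (k < p * q * n)%N ->
    rep_char rho (x ^+ k)%g = rep_char rho' (x ^+ k)%g /\
    rep_char rho (y ^+ k)%g = rep_char rho' (y ^+ k)%g) ->
  torus_fraction z A B = torus_fraction z' A' B'.
Proof.
move=> sp sp' chiE.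
have m_gt0 : (0 < p * q * n)%N by rewrite !muln_gt0 p_gt0 q_gt0 ltnW.
have [Am Bm] := torus_spectra_unity sp; have [Am' Bm'] := torus_spectra_unity sp'.
have AA : perm_eq A A'.
  apply: (perm_eq_power_sums m_gt0 Am Am') => k /chiE[xk _].
  by rewrite -(spectra_trx sp) -(spectra_trx sp').
have BB : perm_eq B B'.
  apply: (perm_eq_power_sums m_gt0 Bm Bm') => k /chiE[_ yk].
  by rewrite -(spectra_try sp) -(spectra_try sp').
rewrite /torus_fraction (perm_big _ AA) (perm_big _ BB).
suff -> : z = z' by [].
have: (0 < size A)%N by rewrite (spectra_sizex sp) ltnW.
case: A sp AA {Am} => // a A sp AA _.
rewrite -(spectra_x sp (mem_head a A)) (spectra_x sp') //.
by rewrite -(perm_mem AA) mem_head.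
Qed.

End TorusAlexander.

Theorem theorem1p1 (R : realType) (p q n : nat)
    (hp : (0 < p)%N) (hq : (0 < q)%N) (hpq : coprime p q) (hn : (2 <= n)%N) :
  (forall (N : nat) (e : 'I_N -> torus_group p q),
     trace_embedding R[i] (torus_group p q) n N e ->
     forall chi0, irr_chars R[i] (torus_group p q) n chi0 ->
     exists V : set (torus_group p q -> R[i]),
       [/\ open_irr_chars n e V, V chi0 &
         exists2 f : {fraction {poly R[i]}}, laurent_over (fun=> True) f &
           forall rho : sl_rep R[i] (torus_group p q) n,
             irreducible_rep rho -> V (rep_char rho) ->
             forall k, eq_upto_unit (torus_alexander rho k) f]) /\
  (forall rho : sl_rep R[i] (torus_group p q) n,
     irreducible_rep rho ->
     forall k, laurent_over (@algebraic_integer R[i]) (torus_alexander rho k)).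
Proof.
split=> [N e emb chi0 chi0_irr|rho irr k]; last first.
  have [z [A [B sp]]] := torus_irr_spectra hp hq hn irr.
  have [Q QI QE] := torus_fraction_integral hp hq hn sp.
  exists ((-1)%:P ^+ (n * (k == ord0)) * Q), 0%N; split.
    apply/integral_coefsM/QI/integral_coefsX/integral_coefsC.
    exact/integral_opp/integral1.
  rewrite (spectra_alexander sp) QE expr0 divr1 rmorphM rmorphXn.
  by rewrite polyCN rmorphN rmorph1.
have [rho0 irr0 chi0E] := chi0_irr.
have [z0 [A0 [B0 sp0]]] := torus_irr_spectra hp hq hn irr0.
have [T TP] := torus_traces_finite R[i] hp hq hn.
pose x := gen (torus_rel p q) ord0; pose y := gen (torus_rel p q) ord_max.
(* These are exactly the elements whose traces are compared in [torus_fraction_traces]. *)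
pose gs := [seq (x ^+ k)%g | k <- iota 0 (p * q * n)] ++
           [seq (y ^+ k)%g | k <- iota 0 (p * q * n)].
have [V [V_open V0 VE]] := open_irr_chars_separating gs T emb chi0_irr.
exists V; split => //; exists (torus_fraction p q n z0 A0 B0).
  have [Q _ ->] := torus_fraction_integral hp hq hn sp0.
  by exists Q, 0%N; rewrite expr0 divr1.
move=> rho irr Vrho k; have [z [A [B sp]]] := torus_irr_spectra hp hq hn irr.
have chiE : {in gs, rep_char rho =1 rep_char rho0}.
  rewrite -chi0E; apply: VE Vrho _ => g.
  by rewrite mem_cat => /orP[] /mapP[j _ ->]; have [] := TP _ _ _ _ sp j.
rewrite (spectra_alexander sp) (torus_fraction_traces hp hq hn sp sp0) => [|j jm].
  (* Only the parity of the sign's exponent matters, and no power of [t] is needed. *)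
  by exists (odd (n * (k == ord0))), 0; rewrite expr0z mulr1 signr_odd.
have j_iota : j \in iota 0 (p * q * n) by rewrite mem_iota.
by split; apply: chiE; rewrite mem_cat map_f ?orbT.
Qed.
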